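(* For any $\varepsilon\in(0,1)$ there exists $\delta>0$ such that if a random vector $\xi=(\xi_1,\ldots,\xi_N)$ in $\mathbb{R}^N$ has independent coordinates and $$ \inf_{c\in\mathbb{R}}\|\xi_i-c\|_{L_0}\ge\varepsilon,\quad i=1,\ldots,N, $$ then for any linear subspace $Q_n\subset\mathbb{R}^N$ of dimension $n\le\delta N$ we have $$ \mathsf{P}\bigl(\rho(\xi,Q_n)_{L_0^N}\le\delta\bigr)\le 2\exp(-\delta N). $$
   Context: For a real random variable $f$, $\|f\|_{L_0}:=\sup\{t\ge 0\colon\mathsf{P}(|f|\ge t)\ge t\}$. For $x\in\mathbb{R}^N$, $\|x\|_{L_0^N}:=\max\{t\ge 0\colon\#\{i\colon|x_i|\ge t\}\ge tN\}$, and $\rho(x,Q)_{L_0^N}:=\inf_{y\in Q}\|x-y\|_{L_0^N}$. *)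

(* Defs.v *)
From mathcomp Require Import all_boot all_order all_algebra.
From mathcomp Require Import all_classical all_reals all_analysis.
Set Implicit Arguments.
Unset Strict Implicit.
Unset Printing Implicit Defensive.
Import Order.TTheory GRing.Theory Num.Theory.
Import numFieldNormedType.Exports.

Local Open Scope classical_set_scope.
Local Open Scope ring_scope.

Definition L0norm (R : realType) (d : measure_display) (T : measurableType d)
    (P : probability T R) (f : T -> R) : R :=
  sup [set t : R | 0 <= t /\ (t%:E <= P [set w | (t <= `|f w|)%R])%E].

(* The maximum is encoded as a supremum; for N > 0 it is attained, see
   [L0Nnorm_max].  For N = 0 there is no maximum and the value is 0. *)
Definition L0Nnorm (R : realType) (N : nat) (x : 'rV[R]_N) : R :=
  sup [set t : R | 0 <= t /\ t * N%:R <= #|[set i | t <= `|x 0 i|]%SET|%:R].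

Definition L0Ndist (R : realType) (N : nat) (x : 'rV[R]_N)
    (Q : {vspace 'rV[R]_N}) : R :=
  inf [set L0Nnorm (x - y) | y in [set y | y \in Q]].

Definition mutually_independent (R : realType) (d : measure_display)
    (T : measurableType d) (P : probability T R) (N : nat)
    (xi : 'I_N -> {RV P >-> R}) : Prop :=
  forall (J : {set 'I_N}) (B : 'I_N -> set R),
    (forall i, measurable (B i)) ->
    P (\bigcap_(i in [set i | i \in J]) (xi i @^-1` B i)) =
      (\prod_(i in J) P (xi i @^-1` B i))%E.

Lemma L0Nnorm_max (R : realType) (N : nat) (x : 'rV[R]_N) : (0 < N)%N ->
  let S := [set t : R | 0 <= t /\
              t * N%:R <= #|[set i | t <= `|x 0 i|]%SET|%:R] in
  S (L0Nnorm x) /\ ubound S (L0Nnorm x).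
Proof.
move=> N0 S; rewrite /L0Nnorm -/S.
have N0R : 0 < N%:R :> R by rewrite ltr0n.
have S0 : S 0 by split=> //; rewrite mul0r.
have hS : has_sup S.
  split; first by exists 0.
  exists 1 => t [_ tS]; rewrite -(ler_pM2r N0R) mul1r (le_trans tS)//.
  by rewrite ler_nat -[leqRHS]card_ord max_card.
have ubS : ubound S (sup S) by exact: sup_upper_bound.
split=> //; split; first exact: ubS.
set s := sup S.
rewrite -ler_pdivlMr//; apply: ge_sup; first by exists 0.
move=> t St; rewrite ler_pdivlMr//.
pose m := \big[Order.max/0]_(i | `|x 0 i| < s) `|x 0 i|.
have [s0|s0] := leP s 0.
  case: (St) => t0 tS.
  have -> : s = t by apply/eqP; rewrite eq_le (le_trans s0 t0) ubS.
  exact: tS.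
have ms : m < s by rewrite /m; elim/big_ind: _ => // a b a_s bs; rewrite gt_max a_s.
have [u Su mu] := sup_adherent (eps := s - m) (ltac:(by rewrite subr_gt0)) hS.
rewrite -/s opprB addrC subrK in mu.
have Sm : S (Order.max t u) by rewrite /Order.max; case: ifP.
case: Sm => _; set v := Order.max t u => vS.
apply: (@le_trans _ _ (v * N%:R)); first by rewrite ler_pM2r// le_max lexx.
apply: (le_trans vS); rewrite ler_nat; apply/subset_leq_card/fintype.subsetP => i.
rewrite !finset.inE => vi; rewrite leNgt; apply/negP => xis.
have : `|x 0 i| <= m by rewrite /m (bigD1 i)//= le_max lexx.
by apply/negP; rewrite -ltNge (lt_le_trans mu)// (le_trans _ vi)// le_max lexx orbT.
Qed.

(* Main.v *)
Require Import Defs.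
From mathcomp Require Import all_boot all_order all_algebra.
From mathcomp Require Import all_classical all_reals all_analysis.
From mathcomp Require Import measurable_realfun ring lra.
Set Implicit Arguments.
Unset Strict Implicit.
Import Order.TTheory GRing.Theory Num.Theory.
Import numFieldNormedType.Exports.

(** The idea is to replace the uncountable family of approximants y in Q by
    the finitely many patterns {i : m_i <= y_i} that they leave on the
    coordinates, for well chosen levels m_i, and to take a union bound.

    A coordinate that stays away from every constant has two separated tails:
    there are m_i, and h, p > 0 depending only on eps, such that xi_i <= m_i - h
    and xi_i >= m_i + h both have probability at least p
    ([two_sided_tails]).  If xi is at L_0^N distance less than eta <= h from Q,
    some y in Q satisfies |xi_i - y_i| < eta for all i outside an exceptional
    set S of at most eta N indices ([L0Ndist_approx]).  For such i, xi_i cannot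
    lie in the lower tail if i belongs to the pattern A of y, nor in the upper
    tail if it does not.  For fixed A and S this excludes for every i outside S
    an event of probability at least p, so that by independence it has
    probability at most exp(-p (1 - eta) N) ([independent_bigcap_le]).

    It remains to count the pairs (A, S).  The patterns of a linear space of
    dimension n shatter no set of more than n indices ([shattered_dim]): n + 1
    coordinates satisfy a linear relation on Q, which forbids one sign vector.
    By Pajor's inequality there are then at most as many patterns as index sets
    of size at most n.  Both A and S therefore range over at most as many
    values as there are index sets of size at most eta N, which is at most
    exp((eta / t + t) N) for every t > 0 ([card_small_sets]).  With t small
    compared to p, and eta small compared to p t, the factor
    exp(-p (1 - eta) N) wins ([probability_dist_le]).

    The union bound is a bound on the measure of the event itself only once
    the event is known to be measurable; this holds because the distance to Q
    is 1-Lipschitz for the sup norm ([measurable_lipschitz_sublevel]). *)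

Local Open Scope classical_set_scope.
Local Open Scope ring_scope.

(** * Shattering and patterns of linear spaces *)

Section Shattering.
Import boot.fintype boot.finset.
Local Open Scope set_scope.

Definition shatters (T : finType) (F : {set {set T}}) (S : {set T}) : bool :=
  [forall A : {set T}, (A \subset S) ==> [exists B in F, B :&: S == A]].

Lemma shattersP (T : finType) (F : {set {set T}}) (S : {set T}) :
  reflect (forall A : {set T}, A \subset S -> exists2 B, B \in F & B :&: S = A)
    (shatters F S).
Proof.
apply: (iffP forallP) => [H A AS|H A].
  have /implyP /(_ AS) /existsP[B /andP[BF /eqP BS]] := H A.
  by exists B.
apply/implyP => /H[B BF BS]; apply/existsP; exists B.
by rewrite BF BS eqxx.
Qed.

(** Pajor's inequality.  Split F according to membership of a point x that
    separates two of its elements.  A set shattered by one half does not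
    contain x and is shattered by F; a set S shattered by both halves accounts
    for two shattered sets of F, S and x |: S. *)
Lemma pajor_inequality (T : finType) (F : {set {set T}}) :
  (#|F| <= #|[set S | shatters F S]|)%N.
Proof.
have [m] := ubnP #|F|; elim: m F => // m IH F; rewrite ltnS => Fm.
have [F1|F1] := leqP #|F| 1.
  have [->|[B BF]] := set_0Vmem F; first by rewrite cards0.
  apply: (leq_trans F1); rewrite card_gt0; apply/set0Pn; exists set0.
  rewrite inE; apply/shattersP => A; rewrite subset0 => /eqP ->.
  by exists B; rewrite ?setI0.
have /card_gt1P[B1 [B2 [B1F B2F B12]]] := F1.
have [x xB] : exists x, (x \in B1) != (x \in B2).
  apply/existsP; rewrite -negb_forall; apply: contra B12 => /forallP H.
  by apply/eqP/setP => x; apply/eqP.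
pose G (b : bool) := [set B in F | (x \in B) == b].
have Gsub b : G b \subset F by apply/subsetP => B; rewrite inE => /andP[].
have G_lt b : (#|G b| < m)%N.
  apply: leq_trans Fm; apply: proper_card; rewrite properE Gsub /=.
  apply: contra xB => /subsetP GF.
  by move: (GF _ B1F) (GF _ B2F); rewrite !inE B1F B2F /= => /eqP -> /eqP ->.
pose Sh b := [set S | shatters (G b) S].
have xSh b S : S \in Sh b -> x \notin S.
  rewrite inE => /shattersP H; apply/negP => xS.
  have [B] := H (if b then set0 else S) (ltac:(by case: (b); rewrite ?sub0set)).
  rewrite inE => /andP[_ /eqP xB'] /setP /(_ x).
  by rewrite in_setI xB' xS; case: (b); rewrite ?inE ?xS.
have Sh1 b S : S \in Sh b -> shatters F S.
  rewrite inE => /shattersP H; apply/shattersP => A /H[B BG <-].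
  by exists B => //; apply: (subsetP (Gsub b)).
have Sh2 S : S \in Sh false :&: Sh true -> shatters F (x |: S).
  rewrite inE => /andP[S0 S1]; have xS := xSh _ _ S0.
  apply/shattersP => A /subsetP AS.
  have [B] : exists2 B, B \in G (x \in A) & B :&: S = A :\ x.
    have := if x \in A as b return S \in Sh b then S1 else S0.
    rewrite inE => /shattersP; apply; apply/subsetP => y.
    rewrite in_setD1 => /andP[yx /AS]; by rewrite in_setU1 (negbTE yx).
  rewrite inE => /andP[BF /eqP xBA] /setP BS; exists B => //.
  apply/setP => y; move: (BS y); rewrite !inE.
  have [-> _|yx /= ->//] := eqVneq y x.
  by rewrite orTb andbT.
pose ShF := [set S | shatters F S].
pose V := [set x |: S | S in Sh false :&: Sh true].
have cV : #|V| = #|Sh false :&: Sh true|.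
  apply: card_in_imset => S S'; rewrite !(in_setI _ (Sh _)) => /andP[/xSh xS _] /andP[/xSh xS' _].
  by move=> /(congr1 (fun C => C :\ x)); rewrite !setU1K.
have dis : (Sh false :|: Sh true) :&: V = set0.
  apply/setP => S; rewrite in_setI in_set0; apply/negP.
  move=> /andP[/setUP SU /imsetP[S' _ SE]].
  by have : x \notin S; [case: SU => /xSh | rewrite SE setU11].
have sub : (Sh false :|: Sh true) :|: V \subset ShF.
  apply/subsetP => S; rewrite inE => /orP[/setUP SU|/imsetP[S' S'S ->]].
    by rewrite inE; case: SU => /Sh1.
  by rewrite inE; apply: Sh2.
apply: leq_trans (subset_leq_card sub).
rewrite cardsU dis cards0 subn0 cV cardsUI.
apply: (@leq_trans (#|G false| + #|G true|)); last by rewrite leq_add// IH.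
rewrite -cardsUI; apply: leq_trans (leq_addr _ _); apply: subset_leq_card.
by apply/subsetP => B BF; rewrite !inE BF; case: (x \in B).
Qed.

(** More indices than the dimension: the coordinates in S, restricted to Q,
    are linearly dependent. *)
Lemma annihilator (K : fieldType) (N : nat) (Q : {vspace 'rV[K]_N})
    (S : {set 'I_N}) : (\dim Q < #|S|)%N ->
  exists2 u : 'I_N -> K, exists2 i, i \in S & u i != 0 &
    forall y, y \in Q -> \sum_(i in S) u i * y 0 i = 0.
Proof.
move=> QS; pose M := \matrix_(i < #|S|, j < \dim Q) (vbasis Q)`_j 0 (enum_val i).
have nf : ~~ row_free M by rewrite -row_leq_rank -ltnNge (leq_ltn_trans (rank_leq_col _)).
have [u uM u0] : exists2 u : 'rV_#|S|, u *m M = 0 & u != 0.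
  move: nf; rewrite -kermx_eq0 => /rowV0Pn[u /sub_kermxP uM u0]; by exists u.
have [k uk] : exists k, u 0 k != 0.
  apply/existsP; rewrite -negb_forall; apply: contra u0 => /forallP H.
  by apply/eqP/rowP => k; rewrite mxE; apply/eqP.
have kS := enum_valP k.
exists (fun i => u 0 (enum_rank_in kS i)).
  by exists (enum_val k) => //; rewrite enum_valK_in.
move=> y yQ.
rewrite (coord_vbasis yQ) big_enum_val.
transitivity (\sum_j coord (vbasis Q) j y * (u *m M) 0 j); last first.
  by rewrite uM big1// => j _; rewrite mxE mulr0.
rewrite [RHS](eq_bigr (fun j => \sum_i u 0 i *
  (coord (vbasis Q) j y * (vbasis Q)`_j 0 (enum_val i)))); last first.
  by move=> j _; rewrite mxE mulr_sumr; apply: eq_bigr => i _; rewrite mxE mulrCA.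
rewrite exchange_big; apply: eq_bigr => i _.
rewrite enum_valK_in summxE mulr_sumr; apply: eq_bigr => j _.
by rewrite mxE.
Qed.

(** If S were larger than the dimension, take a relation sum_S u_i y_i = 0 on
    Q.  An element of Q whose pattern on S is {i : u_i > 0} has all products
    u_i (y_i - m_i) nonnegative, hence sum_S u_i m_i <= 0, strictly if some u_i
    is negative.  Applied to u and to - u this is contradictory. *)
Lemma shattered_dim (R : realFieldType) (N : nat) (Q : {vspace 'rV[R]_N})
    (m : 'I_N -> R) (F : {set {set 'I_N}}) (S : {set 'I_N}) :
  (forall A, A \in F -> exists2 y, y \in Q & A = [set i | m i <= y 0 i]) ->
  shatters F S -> (#|S| <= \dim Q)%N.
Proof.
move=> FQ /shattersP FS; rewrite leqNgt; apply/negP => /annihilator[u].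
move=> [i0 i0S ui0] uQ.
have neg (v : 'I_N -> R) : (forall y, y \in Q -> \sum_(i in S) v i * y 0 i = 0) ->
    \sum_(i in S) v i * m i <= 0 /\ (v i0 < 0 -> \sum_(i in S) v i * m i < 0).
  move=> vQ.
  (* y realizes on S the pattern of the positive coefficients of v. *)
  have [B BF BS] := FS [set i in S | 0 < v i]
    (ltac:(by apply/subsetP => i; rewrite inE => /andP[])).
  have [y yQ BE] := FQ B BF.
  have mE : \sum_(i in S) v i * m i = \sum_(i in S) - (v i * (y 0 i - m i)).
    rewrite [RHS](eq_bigr (fun i => v i * m i - v i * y 0 i)); last first.
      by move=> i _; rewrite mulrBr opprB.
    by rewrite sumrB vQ// subr0.
  have ym i : i \in S -> (m i <= y 0 i) = (0 < v i).
    by move=> iS; move/setP/(_ i): BS; rewrite BE !inE iS /= andbT.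
  have le0 i : i \in S -> - (v i * (y 0 i - m i)) <= 0.
    move=> iS; rewrite oppr_le0; have := ym i iS.
    have [vi|vi] := ltP 0 (v i) => myi; first by rewrite pmulr_rge0// subr_ge0 myi.
    by rewrite mulr_le0 // subr_le0 ltW // ltNge myi.
  rewrite mE; split; first exact: sumr_le0.
  move=> vi0; rewrite (bigD1 i0)//=.
  rewrite -[ltRHS]addr0 ltr_leD//.
    by rewrite oppr_lt0 nmulr_rgt0// subr_lt0 ltNge ym// -leNgt ltW.
  by apply: sumr_le0 => i /andP[iS _]; exact: le0.
have [c0 c0'] := neg u uQ.
have [|d0 d0'] := neg (fun i => - u i).
  move=> y yQ; rewrite (eq_bigr (fun i => - (u i * y 0 i))) => [|i _].
    by rewrite sumrN uQ ?oppr0.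
  by rewrite mulNr.
have E : \sum_(i in S) - u i * m i = - \sum_(i in S) u i * m i.
  by rewrite -sumrN; apply: eq_bigr => i _; rewrite mulNr.
rewrite {}E in d0 d0'.
have [ui|ui|/eqP] := ltgtP (u i0) 0; last by rewrite (negbTE ui0).
  by have := c0' ui; rewrite ltNge -oppr_le0 d0.
by have := d0' (ltac:(by rewrite oppr_lt0)); rewrite oppr_lt0 ltNge c0.
Qed.

End Shattering.

(** * Counting small sets *)

Lemma exprn_le_expR (R : realType) (x : R) (n : nat) : 0 <= x ->
  x ^+ n <= expR (x * n%:R).
Proof.
move=> x0; rewrite expRM_natr lerXn2r ?nnegrE ?expR_ge0//.
by rewrite (le_trans _ (expR_ge1Dx _))// lerDr.
Qed.

(** Chernoff's argument: a set S of size at most k has weight t ^ #|S| at least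
    exp(- k / t), and the total weight of all sets is (1 + t) ^ N. *)
Lemma card_small_sets (R : realType) (N : nat) (k t : R) : 0 < t ->
  #|[set S : {set 'I_N} | #|S|%:R <= k]%SET|%:R <= expR (k / t + t * N%:R).
Proof.
move=> t0.
have -> : expR (k / t + t * N%:R) = expR (k / t) * expR t ^+ N.
  by rewrite expRD -expRM_natr.
apply: (@le_trans _ _ (expR (k / t) * (1 + t) ^+ N)); last first.
  by rewrite ler_pM2l ?expR_gt0// lerXn2r ?nnegrE ?expR_ge0 ?expR_ge1Dx// addr_ge0// ltW.
have -> : (1 + t) ^+ N = \sum_(S : {set 'I_N}) t ^+ #|S|.
  rewrite -[N in LHS]card_ord -prodr_const addrC.
  rewrite bigA_distr; apply: eq_bigr => S _.
  by rewrite -big_mkcond/= prodr_const.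
rewrite mulr_sumr [leRHS](bigID (fun S : {set 'I_N} => #|S|%:R <= k))/=.
rewrite -[leLHS]addr0 lerD//; last first.
  by apply: sumr_ge0 => S _; rewrite mulr_ge0 ?expR_ge0// exprn_ge0// ltW.
rewrite -sum1_card natr_sum; under eq_bigl do rewrite finset.inE.
apply: ler_sum => S Sk.
rewrite -ler_pdivrMr ?exprn_gt0// mul1r -exprVn.
apply: (le_trans (exprn_le_expR _ _)); first by rewrite invr_ge0 ltW.
by rewrite ler_expR mulrC ler_pM2r// invr_gt0.
Qed.

(** * Tails of a random variable that is far from the constants *)

Lemma sup_ge0 (R : realType) (S : set R) : (forall t, S t -> 0 <= t) -> 0 <= sup S.
Proof.
move=> S0; have [[[t St] bS]|/sup_out ->//] := pselect (has_sup S).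
exact: le_trans (S0 t St) (ub_le_sup bS St).
Qed.

Lemma L0norm_ge_tail (R : realType) (d : measure_display) (T : measurableType d)
    (P : probability T R) (f : {RV P >-> R}) (c eps t : R) :
  eps <= inf [set L0norm P (fun w => f w - c) | c in [set: R]] -> 0 < t < eps ->
  (t%:E <= P [set w | (t <= `|f w - c|)%R])%E.
Proof.
move=> epsf /andP[t0 teps].
have mf (u : R) : measurable [set w | u <= `|f w - c|].
  rewrite -[X in measurable X]setTI.
  apply: (@measurable_fun_le _ _ _ setT (cst u) (fun w => `|f w - c|)) => //.
  by apply: measurableT_comp => //; exact: measurable_funB.
have : t < L0norm P (fun w => f w - c).
  apply: (lt_le_trans teps); apply: (le_trans epsf); apply: ge_inf; last by exists c.
  by exists 0 => _ [c' _ <-]; apply: sup_ge0 => u [].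
move=> /sup_gt[|u [u0 uP] tu]; first by exists 0; split.
apply: (@le_trans _ _ u%:E); first by rewrite lee_fin ltW.
apply: (le_trans uP); apply: le_measure; rewrite ?inE//.
by move=> w /=; apply: le_trans; exact: ltW.
Qed.

(** Center at the quantile q = inf {x : P (f <= x) >= t / 2}.  Below q - t there
    is mass less than t / 2, so the mass at least t outside of ]q - t, q + t[
    leaves at least t / 2 above q + t; and there is mass at least t / 2 below
    any point greater than q, such as q + t / 2.  The level m is the midpoint of
    q + t / 2 and q + t. *)
Lemma two_sided_tails (R : realType) (d : measure_display) (T : measurableType d)
    (P : probability T R) (f : {RV P >-> R}) (t : R) : 0 < t -> t < 1 ->
  (forall c, (t%:E <= P [set w | (t <= `|f w - c|)%R])%E) ->
  exists m, ((t / 2)%:E <= P [set w | (f w <= m - t / 4)%R])%E /\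
            ((t / 2)%:E <= P [set w | (m + t / 4 <= f w)%R])%E.
Proof.
move=> t0 t1 ft.
pose A := [set x | ((t / 2)%:E <= cdf f x)%E].
have cdfE x : cdf f x = P [set w | f w <= x] by [].
have A0 : A !=set0.
  have /filter_ex[x /ltW xA] : \forall x \near +oo, ((t / 2)%:E < cdf f x)%E.
    apply: (@cvg_cdfy1 _ _ _ P f [set y | ((t / 2)%:E < y)%E]).
    by apply: open_ereal_gt'; rewrite lte_fin; lra.
  by exists x.
have lA : has_lbound A.
  have /filter_ex[x xA] : \forall x \near -oo, (cdf f x < (t / 2)%:E)%E.
    apply: (@cvg_cdfNy0 _ _ _ P f [set y | (y < (t / 2)%:E)%E]).
    by apply: open_ereal_lt'; rewrite lte_fin; lra.
  exists x => y yA; rewrite leNgt; apply/negP => yx.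
  move: yA; rewrite /A/= leNgt => /negP; apply.
  by apply: le_lt_trans xA; exact/cdf_nondecreasing/ltW.
pose q := inf A.
have [a Aa aq] : exists2 a, A a & a < q + t / 2.
  by apply: inf_lt => //; rewrite ltrDl; lra.
exists (q + 3 * t / 4); split.
  rewrite -cdfE; apply: (le_trans Aa); apply: cdf_nondecreasing; lra.
have Pq : (P [set w | (f w <= q - t)%R] < (t / 2)%:E)%E.
  rewrite -cdfE ltNge; apply/negP => /(ge_inf lA); rewrite -/q; lra.
rewrite leNgt; apply/negP => Pq'.
have := ft q; rewrite leNgt => /negP; apply.
have mle x : measurable [set w | f w <= x].
  rewrite -[X in measurable X]setTI.
  exact: (@measurable_fun_le _ _ _ setT f (cst x)).
have mge x : measurable [set w | x <= f w].
  rewrite -[X in measurable X]setTI.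
  exact: (@measurable_fun_le _ _ _ setT (cst x) f).
apply: (@le_lt_trans _ _ (P ([set w | f w <= q - t] `|` [set w | q + 3 * t / 4 + t / 4 <= f w]))).
  apply: le_measure; rewrite ?inE; [|exact: measurableU|].
    rewrite -[X in measurable X]setTI.
    apply: (@measurable_fun_le _ _ _ setT (cst t) (fun w => `|f w - q|)) => //.
    by apply: measurableT_comp => //; exact: measurable_funB.
  move=> w /=; rewrite ler_normr => /orP[h|h]; [right|left]; lra.
apply: (le_lt_trans (measureU2 _ _ _)) => //.
have -> : t%:E = ((t / 2)%:E + (t / 2)%:E)%E by rewrite -EFinD; congr EFin; lra.
exact: lteD.
Qed.

(** * The L_0^N distance to a linear space *)

Lemma L0Nnorm_ge0 (R : realType) (N : nat) (x : 'rV[R]_N) : 0 <= L0Nnorm x.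
Proof. by apply: sup_ge0 => t []. Qed.

Lemma L0Nnorm_lt_card (R : realType) (N : nat) (x : 'rV[R]_N) (eta : R) :
  0 <= eta -> L0Nnorm x < eta ->
  #|[set i | eta <= `|x 0 i|]%SET|%:R <= eta * N%:R.
Proof.
move=> eta0 xeta; have [N0|N0] := posnP N.
  apply: (@le_trans _ _ 0); last by rewrite mulr_ge0.
  by rewrite lern0 -leqn0 (leq_trans (max_card _))// card_ord N0.
rewrite leNgt; apply/negP => card_gt.
have [_ /(_ eta)] := L0Nnorm_max x N0.
by rewrite leNgt xeta => /(_ (conj eta0 (ltW card_gt))).
Qed.

(** If t > h then |x_i| >= t forces |x'_i| >= t - h. *)
Lemma L0Nnorm_lipschitz (R : realType) (N : nat) (x x' : 'rV[R]_N) (h : R) :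
  0 <= h -> (forall i, `|x 0 i - x' 0 i| <= h) -> L0Nnorm x <= L0Nnorm x' + h.
Proof.
move=> h0 xx'; have [N0|N0] := posnP N.
  by move: x x' xx'; rewrite N0 => x x' _; rewrite (thinmx0 x) (thinmx0 x') lerDl.
have [_ ub'] := L0Nnorm_max x' N0.
apply: ge_sup => [|t [t0 tN]]; first by exists 0; split; rewrite ?mul0r.
have [th|ht] := leP t h; first by rewrite (le_trans th)// lerDr L0Nnorm_ge0.
rewrite -lerBlDr; apply: ub'; split; first by rewrite subr_ge0 ltW.
apply: (@le_trans _ _ (t * N%:R)); first by rewrite ler_wpM2r// gerBl.
apply: (le_trans tN); rewrite ler_nat; apply/subset_leq_card/fintype.subsetP => i.
rewrite !finset.inE lerBlDr => /le_trans; apply.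
by rewrite -[x 0 i](subrK (x' 0 i)) addrC (le_trans (ler_normD _ _))// lerD2l.
Qed.

Lemma L0Ndist_lipschitz (R : realType) (N : nat) (Q : {vspace 'rV[R]_N})
    (x x' : 'rV[R]_N) (h : R) :
  0 <= h -> (forall i, `|x 0 i - x' 0 i| <= h) ->
  L0Ndist x Q <= L0Ndist x' Q + h.
Proof.
move=> h0 xx'; apply/ler_addgt0Pr => e e0; rewrite addrAC.
have [_ [y yQ <-] ye] : exists2 r,
    [set L0Nnorm (x' - y) | y in [set y | y \in Q]] r & r < L0Ndist x' Q + e.
  apply: inf_lt; last by rewrite ltrDl.
  by exists (L0Nnorm (x' - 0)); exists 0 => //=; rewrite mem0v.
apply: (@le_trans _ _ (L0Nnorm (x - y))).
  by apply: ge_inf; [exists 0 => _ [z _ <-]; exact: L0Nnorm_ge0 | exists y].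
apply: (@le_trans _ _ (L0Nnorm (x' - y) + h)); last by rewrite lerD2r ltW.
apply: L0Nnorm_lipschitz => // i.
by rewrite !mxE opprD opprK addrACA addNr addr0.
Qed.

(** A Lipschitz sublevel set is closed; concretely, it is a countable
    intersection over j of the union, over the rational points q with
    D q <= r + 1 / (j + 1), of the preimages of the cubes of radius
    1 / (j + 1) centered at q. *)
Lemma measurable_lipschitz_sublevel (R : realType) (d : measure_display)
    (T : measurableType d) (N : nat) (xi : 'I_N -> T -> R)
    (D : 'rV[R]_N -> R) (r : R) :
  (forall i, measurable_fun setT (xi i)) ->
  (forall (x x' : 'rV[R]_N) (h : R), 0 <= h ->
    (forall i, `|x 0 i - x' 0 i| <= h) -> D x <= D x' + h) ->
  measurable [set w | D (\row_i xi i w) <= r].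
Proof.
move=> mxi DL.
pose q2r (q : {ffun 'I_N -> rat}) : 'rV[R]_N := \row_i ratr (q i).
pose e (j : nat) : R := j.+1%:R^-1.
have e0 j : 0 < e j by rewrite invr_gt0.
pose E j q := [set w | (D (q2r q) <= r + e j) /\ forall i, `|xi i w - ratr (q i)| <= e j].
have mE j q : measurable (E j q).
  have [Dq|Dq] := leP (D (q2r q)) (r + e j); last first.
    rewrite (_ : E j q = set0)//; apply/seteqP; split => // w [].
    by rewrite leNgt Dq.
  rewrite (_ : E j q = \bigcap_(i in [set: 'I_N]) [set w | `|xi i w - ratr (q i)| <= e j]).
    apply: fin_bigcap_measurable => // i _.
    rewrite -[X in measurable X]setTI.
    apply: (@measurable_fun_le _ _ _ setT (fun w => `|xi i w - ratr (q i)|) (cst (e j))) => //.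
    by apply: measurableT_comp => //; exact: measurable_funB.
  apply/seteqP; split => [w [_ wE] i _|w wE]; first exact: wE.
  by split => // i; exact: wE.
rewrite (_ : [set w | _] = \bigcap_j \bigcup_q E j q).
  apply: bigcapT_measurable => j; apply: countable_bigcupT_measurable => //.
apply/seteqP; split => [w /= Dw j _|w Ew /=].
  have qP i : exists q : rat, `|xi i w - ratr q| <= e j.
    have [q] := @rat_in_itvoo R (xi i w - e j) (xi i w + e j) (ltac:(by have := e0 j; lra)).
    rewrite in_itv/= => /andP[h1 h2]; exists q; rewrite ler_norml; apply/andP; split; lra.
  exists [ffun i => projT1 (cid (qP i))] => //; split; last first.
    by move=> i; rewrite ffunE; case: cid.
  apply: le_trans (lerD Dw (lexx _)); apply: DL; first exact: ltW.
  by move=> i; rewrite !mxE ffunE distrC; case: cid.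
apply/ler_addgt0Pr => eps eps0.
have [j je] : exists j, e j + e j <= eps.
  have [j jP] := @ltr_add_invr R 0 (eps / 2) (ltac:(lra)).
  by exists j; rewrite (splitr eps) lerD// -[e j]add0r ltW.
have [q _ [Dq xq]] := Ew j I.
apply: (@le_trans _ _ (D (q2r q) + e j)).
  by apply: DL => [|i]; [exact: ltW | rewrite !mxE].
by lra.
Qed.

Lemma L0Ndist_approx (R : realType) (N : nat) (Q : {vspace 'rV[R]_N})
    (x : 'rV[R]_N) (eta : R) : 0 <= eta -> L0Ndist x Q < eta ->
  exists2 y, y \in Q & #|[set i | eta <= `|x 0 i - y 0 i|]%SET|%:R <= eta * N%:R.
Proof.
move=> eta0 /inf_lt[|_ [y yQ <-] /(L0Nnorm_lt_card eta0) xy].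
  by exists (L0Nnorm (x - 0)); exists 0 => //=; rewrite mem0v.
by exists y => //; move: xy; under eq_finset do rewrite !mxE.
Qed.

(** * Union bound *)

Lemma independent_bigcap_le (R : realType) (d : measure_display)
    (T : measurableType d) (P : probability T R) (N : nat)
    (xi : 'I_N -> {RV P >-> R}) (B : 'I_N -> set R) (S : {set 'I_N}) (p : R) :
  mutually_independent xi -> (forall i, measurable (B i)) ->
  (forall i, (P (xi i @^-1` B i) <= (1 - p)%:E)%E) ->
  (P (\bigcap_(i in [set i | i \in S]) (xi i @^-1` B i)) <= (expR (- p * #|S|%:R))%:E)%E.
Proof.
move=> ind mB PB; rewrite ind//.
rewrite expRM_natr -prodr_const.
suff [] : (0 <= \prod_(i in S) P (xi i @^-1` B i))%E /\
    (\prod_(i in S) P (xi i @^-1` B i) <= (\prod_(i in S) expR (- p))%:E)%E by [].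
apply: (big_rec2 (fun x y => (0 <= x)%E /\ (x <= y%:E)%E)) => // i y x _ [y0 yx].
split; first by rewrite mule_ge0.
rewrite EFinM; apply: lee_pmul => //; apply: (le_trans (PB i)).
by rewrite lee_fin expR_ge1Dx.
Qed.

Lemma union_bound (R : realType) (d : measure_display) (T : measurableType d)
    (P : probability T R) (I : finType) (D : {set I}) (E : I -> set T)
    (A : set T) (c : R) :
  measurable A -> (forall i, measurable (E i)) ->
  (forall i, i \in D -> (P (E i) <= c%:E)%E) ->
  A `<=` \bigcup_(i in [set` D]) E i ->
  (P A <= (c * #|D|%:R)%:E)%E.
Proof.
move=> mA mE PE AE.
apply: (@le_trans _ _ (\sum_(i \in [set` enum D]) P (E i))%E).
  apply: content_sub_fsum => // w /AE[i /= iD Ei].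
  by exists i => //=; rewrite mem_enum.
rewrite -fsbig_seq ?enum_uniq// big_enum/=.
apply: (@le_trans _ _ (\sum_(i in D) c%:E)%E); first exact: lee_sum.
by rewrite sumEFin sumr_const mulr_natr.
Qed.

(** The union bound over patterns A and exceptional sets S.  Both families have
    at most exp((eta / t + t) N) members, and each pair contributes at most
    exp(- p (1 - eta) N).  The parameters are left free, to be balanced in the
    final theorem. *)
Lemma probability_dist_le (R : realType) (d : measure_display)
    (T : measurableType d) (P : probability T R) (N : nat)
    (xi : 'I_N -> {RV P >-> R}) (m : 'I_N -> R) (p h eta t delta : R)
    (Q : {vspace 'rV[R]_N}) :
  mutually_independent xi ->
  (forall i, (p%:E <= P [set w | (xi i w <= m i - h)%R])%E) ->
  (forall i, (p%:E <= P [set w | (m i + h <= xi i w)%R])%E) ->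
  0 <= p -> 0 < t -> 0 <= delta < eta -> eta <= h ->
  (\dim Q)%:R <= eta * N%:R ->
  (P [set w | (L0Ndist (\row_i xi i w) Q <= delta)%R] <=
    (expR ((2 * (eta / t + t) - p * (1 - eta)) * N%:R))%:E)%E.
Proof.
move=> ind lo hi p0 t0 /andP[delta0 deltaeta] etah dimQ.
have eta0 : 0 <= eta by rewrite (le_trans delta0)// ltW.
pose small := [set S : {set 'I_N} | #|S|%:R <= eta * N%:R]%SET.
pose pats := [set A : {set 'I_N} | `[< exists2 y, y \in Q & A = [set i | m i <= y 0 i]%SET >]]%SET.
have card_pats : (#|pats| <= #|small|)%N.
  apply: (leq_trans (pajor_inequality pats)); apply/subset_leq_card/fintype.subsetP => S.
  rewrite !finset.inE => patsS; apply: le_trans dimQ; rewrite ler_nat.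
  by apply: (@shattered_dim _ _ _ m) patsS => A; rewrite finset.inE => /asboolP.
pose B (A : {set 'I_N}) i : set R :=
  if i \in A then [set` `]m i - h, +oo[] else [set` `]-oo, m i + h[].
have mB A i : measurable (B A i) by rewrite /B; case: ifP.
have PB A i : (P (xi i @^-1` B A i) <= (1 - p)%:E)%E.
  have mPB : measurable (xi i @^-1` B A i) by exact: measurable_funPTI.
  suff H : (p%:E <= P (~` (xi i @^-1` B A i)))%E.
    rewrite -[X in P X]setCK probability_setC; last exact: measurableC.
    by rewrite EFinB; apply: leeB.
  rewrite /B; case: ifP => _.
    rewrite (_ : ~` _ = [set w | xi i w <= m i - h])//.
    by apply/seteqP; split => w /=; rewrite in_itv/= andbT leNgt => /negP.
  rewrite (_ : ~` _ = [set w | m i + h <= xi i w])//.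
  by apply/seteqP; split => w /=; rewrite in_itv/= leNgt => /negP.
(* Off S, no coordinate falls in the tail that the pattern A excludes. *)
pose ev (AS : {set 'I_N} * {set 'I_N}) :=
  \bigcap_(i in [set i | i \in ~: AS.2]) (xi i @^-1` B AS.1 i).
have mev AS : measurable (ev AS).
  by apply: fin_bigcap_measurable => // i _; exact: measurable_funPTI.
pose D := finset.setX pats small.
have cover : [set w | L0Ndist (\row_i xi i w) Q <= delta] `<=` \bigcup_(AS in [set` D]) ev AS.
  move=> w /= wd; have [y yQ yS] := L0Ndist_approx eta0 (le_lt_trans wd deltaeta).
  exists ([set i | m i <= y 0 i], [set i | eta <= `|(\row_i xi i w) 0 i - y 0 i|])%SET.
    rewrite /= !finset.inE yS andbT; apply/asboolP; by exists y.
  move=> i /=; rewrite !finset.inE -ltNge mxE ltr_norml => /andP[h1 h2].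
  by rewrite /B finset.inE; case: leP => my; rewrite /= in_itv/= ?andbT; lra.
have mD : measurable [set w | L0Ndist (\row_i xi i w) Q <= delta].
  apply: (@measurable_lipschitz_sublevel _ _ _ _ (fun i => xi i : T -> R)
    (fun x => L0Ndist x Q)) => //.
  by move=> x x' r r0; exact: L0Ndist_lipschitz.
have card_D : #|D|%:R <= expR (2 * (eta / t + t) * N%:R).
  have card_small : #|small|%:R <= expR ((eta / t + t) * N%:R).
    apply: (le_trans (card_small_sets N (eta * N%:R) t0)).
    by rewrite ler_expR mulrDl mulrAC.
  rewrite cardsX natrM -mulrA mulr2n mulrDl !mul1r expRD.
  apply: ler_pM => //; apply: le_trans card_small.
  by rewrite ler_nat.
apply: (@le_trans _ _ ((expR (- p * ((1 - eta) * N%:R)) * #|D|%:R)%:E)).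
  apply: union_bound cover => // -[A S]; rewrite finset.inE => /andP[_ /=].
  rewrite finset.inE => Ssmall.
  apply: (le_trans (independent_bigcap_le (~: S)%SET ind (mB A) (PB A))).
  rewrite lee_fin ler_expR ler_wnM2l ?oppr_le0//.
  have -> : #|~: S|%SET%:R = N%:R - #|S|%:R :> R.
    have /(congr1 (fun k => k%:R : R)) : (#|S| + #|~: S|)%N = N by rewrite cardsC card_ord.
    by rewrite natrD => <-; rewrite addrAC subrr add0r.
  by rewrite mulrBl mul1r lerD2l lerN2.
rewrite lee_fin [leRHS](_ : _ = expR (- p * ((1 - eta) * N%:R)) *
  expR (2 * (eta / t + t) * N%:R)); last by rewrite -expRD; congr expR; ring.
by rewrite ler_pM2l ?expR_gt0.
Qed.

Theorem theorem3p2 (R : realType) (eps : R) (eps_gt0 : 0 < eps)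
    (eps_lt1 : eps < 1) :
  exists2 delta : R, 0 < delta &
    forall (d : measure_display) (T : measurableType d) (P : probability T R)
      (N : nat) (xi : 'I_N -> {RV P >-> R}),
      mutually_independent xi ->
      (forall i : 'I_N,
        eps <= inf [set L0norm P (fun w => xi i w - c) | c in [set: R]]) ->
      forall (n : nat) (Q : {vspace 'rV[R]_N}),
        \dim Q = n -> n%:R <= delta * N%:R ->
        (P [set w | (L0Ndist (\row_i xi i w) Q <= delta)%R]
           <= (2 * expR (- (delta * N%:R)))%:E)%E.
Proof.
(* p and eps / 8 are the mass and the half-gap of the tails at level eps / 2.
   With t = p / 8 this eta makes eta / t = p / 16, so the exponent is at most
   - (5 / 8 - eta) p N, which is below - eta N / 2. *)
pose p := eps / 4; pose eta := p ^+ 2 / 128.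
have p0 : 0 < p by rewrite divr_gt0.
have p1 : p < 1 / 4 by rewrite /p; lra.
have eta0 : 0 < eta by rewrite divr_gt0// exprn_gt0.
have etap : eta <= p / 128.
  by rewrite /eta ler_pM2r// expr2 ger_pMr//; lra.
have he0 : 0 < eps / 2 by rewrite divr_gt0.
have he1 : eps / 2 < 1 by lra.
have heE : eps / 2 < eps by lra.
have pE : p = eps / 2 / 2 by rewrite /p; lra.
have e8E : eps / 8 = eps / 2 / 4 by lra.
exists (eta / 2); first by rewrite divr_gt0.
move=> d T P N xi ind xi_eps n Q dimQ nN.
have /choice[m mP] : forall i, exists m,
    (p%:E <= P [set w | (xi i w <= m - eps / 8)%R])%E /\
    (p%:E <= P [set w | (m + eps / 8 <= xi i w)%R])%E.
  move=> i; have [|m [lo hi]] := @two_sided_tails _ _ _ P (xi i) (eps / 2) he0 he1.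
    by move=> c; apply: L0norm_ge_tail (xi_eps i) _; rewrite he0.
  by exists m; rewrite pE e8E.
have dimQ' : (\dim Q)%:R <= eta * N%:R.
  by rewrite dimQ (le_trans nN)// ler_wpM2r//; lra.
apply: (le_trans (@probability_dist_le _ _ _ _ _ _ m p (eps / 8) eta (p / 8) _ _
  ind (fun i => (mP i).1) (fun i => (mP i).2) _ _ _ _ dimQ')).
- exact: ltW.
- by rewrite divr_gt0.
- by apply/andP; split; lra.
- by move: etap; rewrite /p; lra.
rewrite lee_fin -[leLHS]mul1r ler_pM// ?expR_ge0 ?ler1n// ler_expR.
rewrite -[leRHS]mulNr ler_wpM2r//.
have -> : eta / (p / 8) = p / 16 by rewrite /eta; field; exact: lt0r_neq0.
have : p * eta <= eta by rewrite ger_pMl//; lra.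
rewrite mulrBr mulr1; lra.
Qed.
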